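(* For every infinite word $w$ over a finite alphabet and for every positive integer $n$, $$eL_w(n) \leq C_w(n)-C_w(n-1)+1,$$ where $eL_w$ is the extended Lie complexity function of $w$ and $C_w(m)$ is the number of length-$m$ factors of $w$.
   Context: A factor of $w$ is a finite block of contiguous letters of $w$ (the empty word is a factor, so $C_w(0)=1$). $\mathrm{Fac}(w)$ is the set of all factors of $w$. Two finite words $u,v$ are conjugate if $u=xy$ and $v=yx$ for some words $x,y$; $[u]$ is the conjugacy class of $u$. A finite word is primitive if it is not a power $v^k$ ($k$ a natural number) of another word (in particular the empty word is not primitive); $\mathrm{Prim}(w)$ is the set of primitive factors of $w$. For a nonempty finite word $u$ and a positive rational $\alpha$ with $\alpha|u|$ an integer, $u^\alpha$ is the prefix of length $\alpha|u|$ of the infinite word $uuu\cdots$. For a positive integer $n$, $[u]_n=\{v^{n/|v|} : v\in[u]\}$ (a set of words of length $n$). The extended Lie complexity function is defined, for positive $n$, by $$eL_w(n)=\bigl|\{[p]_n : [p]_n\subset\mathrm{Fac}(w),\ n\geq|p|,\ p\in\mathrm{Prim}(w)\}\bigr|,$$ i.e. the number of distinct sets $[p]_n$ of this kind. *)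

(* Defs.v *)
(* MathComp, with the classical reflection `[< P >] of mathcomp.classical.boolp. *)
From HB Require Import structures.
From mathcomp Require Import all_boot all_order all_algebra.
From mathcomp Require Import boolp.
Set Implicit Arguments.
Unset Strict Implicit.
Unset Printing Implicit Defensive.
Import Order.TTheory GRing.Theory Num.Theory.

Section Words.
Variable A : finType.
Implicit Types (u v p : seq A) (w : nat -> A).

Definition block w (i m : nat) : seq A := mkseq (fun j => w (i + j)) m.

Definition Fac w u : Prop := exists i, u = block w i (size u).

Definition Facn w (n : nat) : {set n.-tuple A} := [set t | `[< Fac w (tval t) >]].

Definition complexity w (n : nat) : nat := #|Facn w n|.

Definition conjugate u v : Prop := exists x y, u = x ++ y /\ v = y ++ x.

Definition npow v (k : nat) : seq A := flatten (nseq k v).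

(* The exponent k = 0 is allowed, so over a nonempty alphabet (which the
   existence of an infinite word forces) the empty word is not primitive. *)
Definition primitive u : Prop := ~ exists v k, v <> u /\ u = npow v k.

Definition Prim w u : Prop := Fac w u /\ primitive u.

(* The infinite word (x :: s)(x :: s)(x :: s)...  *)
Definition omega (x : A) (s : seq A) : nat -> A :=
  fun i => nth x (x :: s) (i %% (size s).+1).

(* u^alpha, meant for u nonempty and alpha * |u| a natural number, in which case
   the truncation is exact; the value on the empty word is a dummy. *)
Definition rpow u (alpha : rat) : seq A :=
  if u is x :: s then
    block (omega x s) 0 (Num.truncn (alpha * (size u)%:R)%R)
  else [::].

(* [p]_n. For p nonempty every v^(n/|v|) has length n, so that indexing by
   n-tuples loses nothing. *)
Definition classn p (n : nat) : {set n.-tuple A} :=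
  [set t | `[< exists2 v, conjugate p v &
                 tval t = rpow v (n%:R / (size v)%:R)%R >]].

Definition extLie w (n : nat) : nat :=
  #|[set S : {set n.-tuple A} | `[< exists p,
       [/\ Prim w p, size p <= n, classn p n \subset Facn w n
         & S = classn p n] >]]|.

End Words.

(* Main.v *)
Require Import Defs.
From mathcomp Require Import all_boot all_order all_algebra.
From mathcomp Require Import boolp zify.

Set Implicit Arguments.
Unset Strict Implicit.
Unset Printing Implicit Defensive.

(** Consider the graph whose vertices are the factors of w of length n - 1 and
    whose edges are the factors of length n, each going from its prefix to its
    suffix of length n - 1.  Reading w from left to right is a walk through all
    vertices, so the graph is connected.  A set [p]_n of factors of w is a
    closed walk in it, made of the |p| windows of length n on ppp...

    Each such cycle has an edge of its own.  A primitive p has an unbordered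
    conjugate v, for instance the lexicographically least one
    ([exists_unbordered]).  The prefix of length n of vvv... then has |p| as
    its least period, because a smaller one would give a border of v.  Hence
    this marked edge lies on no class [p']_n with |p'| <= |p| other than [p]_n
    itself ([marked_min]).

    So distinct classes have distinct marked edges.  Remove all of these.
    The rest of the class of p still joins the two ends of its marked edge
    ([cycle_potential]); this detour may use marked edges of other classes, but
    only of classes of strictly shorter words, which by induction on |p| can
    themselves be bypassed.  So the remaining graph is connected and has at
    least C(n-1) - 1 edges ([connected_card_le]), that is
    C(n) - eL(n) >= C(n-1) - 1.

    Connectedness is expressed throughout by potentials: a boolean function on
    the vertices that takes equal values at the two ends of every edge is
    constant. *)

(** * Connected graphs have enough edges *)

(** Over the field with two elements, the coboundary map from functions on the
    vertices to functions on the edges has only constants in its kernel, so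
    together with the value at [v0] it is injective, and 2^|D| <= 2 * 2^|K|. *)
Lemma connected_card_le (V E : finType) (s t : E -> V) (D : {set V})
    (K : {set E}) (v0 : V) :
    (forall f : V -> bool, {in K, forall e, f (s e) = f (t e)} ->
       {in D, forall v, f v = f v0}) ->
  #|D| <= #|K|.+1.
Proof.
move=> conn.
(* A subset of D stands for a 0-1 function on the vertices. *)
pose F (X : {set V}) := (v0 \in X, [set e in K | (s e \in X) (+) (t e \in X)]).
have injF : {in powerset D &, injective F}.
  move=> X Y; rewrite !inE => sXD sYD [eq0 eqK].
  have XY := conn (fun v => (v \in X) (+) (v \in Y)).
  have {}XY : {in D, forall v, (v \in X) (+) (v \in Y)
                             = (v0 \in X) (+) (v0 \in Y)}.
    apply: XY.
    move=> e eK; move/setP/(_ e): eqK; rewrite !inE eK /=.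
    by case: (s e \in X); case: (t e \in X); case: (s e \in Y);
      case: (t e \in Y).
  apply/setP=> v; case: (boolP (v \in D)) => [vD | vD].
    by move: (XY v vD); rewrite eq0 addbb; case: (v \in X); case: (v \in Y).
  by rewrite (contraNF (subsetP sXD v) vD) (contraNF (subsetP sYD v) vD).
have sub : F @: powerset D \subset setX [set: bool] (powerset K).
  apply/subsetP=> _ /imsetP[X _ ->]; rewrite !inE /=.
  by apply/subsetP=> e; rewrite inE => /andP[].
move: (subset_leq_card sub).
by rewrite (card_in_imset injF) cardsX !card_powerset cardsT card_bool -expnS
  leq_exp2l.
Qed.

Section Words.
Variable A : finType.
Implicit Types (q w : nat -> A) (u v p : seq A).

(** * Lexicographic comparison of words of equal length *)

(** The value of a word in base #|A|.  On words of the same length its order is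
    the lexicographic one. *)
Fixpoint code u : nat :=
  if u is a :: u' then enum_rank a * #|A| ^ size u' + code u' else 0.

Lemma code_lt u : code u < #|A| ^ size u.
Proof.
elim: u => //= a u IHu; rewrite expnS.
have lt_a := ltn_ord (enum_rank a).
apply: leq_trans (_ : (enum_rank a).+1 * #|A| ^ size u <= _).
  by rewrite mulSn addnC ltn_add2r.
by rewrite leq_mul2r lt_a orbT.
Qed.

Lemma code_cat u v : code (u ++ v) = code u * #|A| ^ size v + code v.
Proof.
by elim: u => //= a u ->; rewrite size_cat expnD mulnDl addnA mulnA.
Qed.

Lemma code_inj u v : size u = size v -> code u = code v -> u = v.
Proof.
elim: u v => [|a u IHu] [|b v] //= [eq_sz].
have lt_u := code_lt u; have lt_v := code_lt v.
rewrite -eq_sz in lt_v *; move=> eq_code.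
have B0 : 0 < #|A| ^ size u by apply: leq_ltn_trans lt_u.
have eq_ab : a = b.
  apply/enum_rank_inj/val_inj.
  move/(congr1 (divn^~ (#|A| ^ size u))): eq_code.
  by rewrite !divnMDl // !divn_small // !addn0.
by move: eq_code; rewrite eq_ab => /addnI/(IHu _ eq_sz) ->.
Qed.

(** * Periodic infinite words *)

Lemma block_add q i m l : block q i (m + l) = block q i m ++ block q (i + m) l.
Proof.
rewrite /block /mkseq iotaD map_cat add0n; congr (_ ++ _).
rewrite -[m in iota m l]addn0 iotaDl -map_comp.
by apply: eq_map => j /=; rewrite addnA.
Qed.

Lemma size_block q i m : size (block q i m) = m.
Proof. exact: size_mkseq. Qed.

Lemma eq_block q q' i i' m :
  (forall j, j < m -> q (i + j) = q' (i' + j)) <-> block q i m = block q' i' m.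
Proof.
split=> [eqq | eqb j jm].
  by apply/eq_in_map => j; rewrite mem_iota => /eqq.
by move/(congr1 (fun u => nth (q 0) u j)): eqb; rewrite !nth_mkseq.
Qed.

Definition periodic (d : nat) q := forall i, q (i + d) = q i.

Lemma periodic_mul d q m : periodic d q -> periodic (m * d) q.
Proof.
move=> qd; elim: m => [|m IHm] i; first by rewrite addn0.
by rewrite mulSnr addnA qd.
Qed.

Lemma periodic_block k q i m :
  periodic k q -> block q (i + k) m = block q i m.
Proof.
by move=> qk; apply/eq_block => j _; rewrite addnAC qk.
Qed.

Lemma periodic_gcd d k q :
  0 < d -> periodic d q -> periodic k q -> periodic (gcdn d k) q.
Proof.
move=> d0 qd qk i; case: (egcdnP k d0) => a b eq_ab _.
rewrite -(periodic_mul a qd i) eq_ab [b * k + _]addnC addnA.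
by rewrite (periodic_mul b qk).
Qed.

Lemma periodic_npow g m q :
  periodic g q -> block q 0 (m * g) = npow (block q 0 g) m.
Proof.
move=> qg; elim: m => // m IHm.
by rewrite mulSn block_add periodic_block // IHm.
Qed.

Lemma eq_periodic k q q' i i' :
    0 < k -> periodic k q -> periodic k q' ->
    (forall j, j < k -> q (i + j) = q' (i' + j)) ->
  forall j, q (i + j) = q' (i' + j).
Proof.
move=> k0 qk qk' eqk j; rewrite (divn_eq j k) [_ * k + _]addnC !addnA.
by rewrite (periodic_mul _ qk) (periodic_mul _ qk') eqk // ltn_mod.
Qed.

(** The word of length k at position r of q has no border: a proper border of
    length k - d is the same thing as a period d. *)
Definition unbordered_at q r k :=
  forall d, 0 < d < k -> ~ (forall j, j + d < k -> q (r + d + j) = q (r + j)).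

Lemma exists_min (F : nat -> nat) : exists r, forall s, F r <= F s.
Proof.
have exF : exists c, `[< exists r, F r = c >].
  by exists (F 0); apply/asboolP; exists 0.
case: (ex_minnP exF) => c /asboolP[r <-] minr; exists r => s.
by apply: minr; apply/asboolP; exists s.
Qed.

(** The lexicographically least conjugate of a primitive word is unbordered.  If
    it had a border u, so that it were both zu and uy, comparing it with its
    conjugates uz and yu would give y <= z and z <= y.  Then zu = uz, and the
    infinite word would be invariant under a shift shorter than k. *)
Lemma exists_unbordered q k :
    0 < k -> periodic k q -> (forall d, 0 < d < k -> ~ periodic d q) ->
  exists r, unbordered_at q r k.
Proof.
move=> k0 qk prim.
have [r minr] := exists_min (fun i => code (block q i k)).
exists r => d /andP[d0 dk] bord; apply: (prim d); first by rewrite d0.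
set u := block q r (k - d); set z := block q r d.
set y := block q (r + (k - d)) d.
have u_d : block q (r + d) (k - d) = u.
  by apply/eq_block => j jk; rewrite bord //; lia.
have v_zu : block q r k = z ++ u.
  by rewrite -{1}(subnKC (ltnW dk)) block_add u_d.
have v_uy : block q r k = u ++ y.
  by rewrite -{1}(subnK (ltnW dk)) block_add.
have rot_uz : block q (r + d) k = u ++ z.
  rewrite -{1}(subnK (ltnW dk)) block_add u_d -addnA subnKC ?(ltnW dk) //.
  by rewrite (periodic_block _ _ qk).
have rot_yu : block q (r + (k - d)) k = y ++ u.
  rewrite -{2}(subnKC (ltnW dk)) block_add -addnA subnK ?(ltnW dk) //.
  by rewrite (periodic_block _ _ qk).
have le_yz : code y <= code z.
  move: (minr (r + d)); rewrite v_uy rot_uz !code_cat /y /z !size_block.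
  by rewrite leq_add2l.
have le_zy : code z <= code y.
  move: (minr (r + (k - d))); rewrite v_zu rot_yu !code_cat leq_add2r.
  by rewrite leq_pmul2r // (leq_ltn_trans _ (code_lt u)).
have eq_yz : y = z.
  apply: code_inj; first by rewrite !size_block.
  by apply/eqP; rewrite eqn_leq le_yz.
have shift : forall j, q (r + d + j) = q (r + j).
  apply: (eq_periodic k0 qk qk); apply/eq_block.
  by rewrite rot_uz v_uy eq_yz.
(* [shift] starts at position r; moving by r whole periods covers all i. *)
move=> i; rewrite -(periodic_mul r qk i) -(periodic_mul r qk (i + d)).
have rk : r <= r * k by rewrite leq_pmulr.
have := shift (i + (r * k - r)).
have -> : r + d + (i + (r * k - r)) = i + d + r * k by lia.
by have -> : r + (i + (r * k - r)) = i + r * k by lia.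
Qed.

(** * Factors of infinite words as tuples *)

Definition factor_at q i n : n.-tuple A := [tuple q (i + j) | j < n].

Lemma val_factor_at q i n : factor_at q i n = block q i n :> seq A.
Proof. by rewrite /block /mkseq -val_enum_ord -map_comp. Qed.

Lemma eq_factor_at q q' i i' n :
  (forall j, j < n -> q (i + j) = q' (i' + j)) <->
  factor_at q i n = factor_at q' i' n.
Proof.
rewrite eq_block -!val_factor_at; split=> [/val_inj // | -> //].
Qed.

Lemma in_FacnP w n (t : n.-tuple A) :
  reflect (exists i, t = factor_at w i n) (t \in Facn w n).
Proof.
rewrite inE; apply: (iffP (asboolP _)) => -[i ti]; exists i.
  by apply: val_inj; rewrite /= ti size_tuple -val_factor_at.
by rewrite size_tuple -val_factor_at -ti.
Qed.

Definition init_tuple n (t : n.+1.-tuple A) : n.-tuple A :=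
  [tuple tnth t (widen_ord (leqnSn n) j) | j < n].

Definition tail_tuple n (t : n.+1.-tuple A) : n.-tuple A :=
  [tuple tnth t (lift ord0 j) | j < n].

Lemma init_factor_at q i n :
  init_tuple (factor_at q i n.+1) = factor_at q i n.
Proof. by apply: eq_from_tnth => j; rewrite !tnth_mktuple. Qed.

Lemma tail_factor_at q i n :
  tail_tuple (factor_at q i n.+1) = factor_at q i.+1 n.
Proof.
by apply: eq_from_tnth => j; rewrite !tnth_mktuple lift0 addnS addSn.
Qed.

(** * The classes [p]_n as cycles *)

Definition repeat_word (x0 : A) p : nat -> A := fun i => nth x0 p (i %% size p).

Lemma periodic_repeat x0 p : periodic (size p) (repeat_word x0 p).
Proof. by move=> i; rewrite /repeat_word modnDr. Qed.

Lemma block_repeat x0 p : block (repeat_word x0 p) 0 (size p) = p.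
Proof.
apply: (@eq_from_nth _ x0); rewrite size_block // => i ip.
by rewrite nth_mkseq // /repeat_word modn_small.
Qed.

(** The empty word is the power of exponent 0 of any letter. *)
Lemma primitive_size (x0 : A) p : primitive p -> 0 < size p.
Proof. by case: p => // prim; case: prim; exists [:: x0], 0. Qed.

(** Another period d of ppp... would make g = gcd(d, |p|) a period, and p a
    power of its prefix of length g. *)
Lemma primitive_repeat x0 p d :
  primitive p -> 0 < d < size p -> ~ periodic d (repeat_word x0 p).
Proof.
move=> prim /andP[d0 dp] qd; apply: prim.
set q := repeat_word x0 p in qd; set g := gcdn d (size p).
have qg : periodic g q by apply: periodic_gcd => //; apply: periodic_repeat.
exists (block q 0 g), (size p %/ g); split.
  move/(congr1 size); rewrite size_block => gp.
  by move: dp; rewrite -gp ltnNge dvdn_leq ?dvdn_gcdl.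
by rewrite -periodic_npow // divnK ?dvdn_gcdr ?block_repeat.
Qed.

Lemma conjugate_repeat x0 p v : 0 < size p ->
  conjugate p v <-> exists i, v = block (repeat_word x0 p) i (size p).
Proof.
move=> p0; have qk := periodic_repeat x0 p; split.
  case=> x [y [eqp ->]]; exists (size x).
  have sz : size p = size x + size y by rewrite eqp size_cat.
  have /eqP : block (repeat_word x0 p) 0 (size x + size y) = x ++ y.
    by rewrite -sz block_repeat.
  rewrite block_add eqseq_cat ?size_block // => /andP[/eqP ex /eqP ey].
  rewrite sz addnC block_add ey -sz -[size p]add0n.
  by rewrite (periodic_block _ _ qk) ex.
case=> i ->; set q := repeat_word x0 p; set r := i %% size p.
have r_lt : r < size p by rewrite ltn_mod.
exists (block q 0 r), (block q r (size p - r)); split.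
  by rewrite -[p in LHS](block_repeat x0) -{1}(subnKC (ltnW r_lt)) block_add.
have -> : block q i (size p) = block q r (size p).
  by apply/eq_block => j _; rewrite /q /repeat_word modnDml.
rewrite -{1}(subnK (ltnW r_lt)) block_add subnKC ?(ltnW r_lt) //.
by rewrite -[X in block q X r]add0n periodic_block.
Qed.

Lemma rpow_block q i k n : 0 < k -> periodic k q ->
  rpow (block q i k) (n%:R / k%:R)%R = block q i n.
Proof.
move=> k0 qk; case eqv: (block q i k) => [|x s].
  by move: (size_block q i k); rewrite eqv /= => k_eq; rewrite -k_eq in k0.
have sz : (size s).+1 = k by rewrite -(size_block q i k) eqv.
rewrite /rpow [size (x :: s)]/= sz.
rewrite GRing.divfK ?Num.Theory.pnatr_eq0 -?lt0n // Num.Theory.natrK.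
apply/eq_block => j _; rewrite /omega sz -eqv nth_mkseq ?ltn_mod // add0n.
by rewrite [in RHS](divn_eq j k) [_ * k + _]addnC addnA (periodic_mul _ qk).
Qed.

Lemma in_classnP x0 p n (t : n.-tuple A) : 0 < size p ->
  reflect (exists i, t = factor_at (repeat_word x0 p) i n) (t \in classn p n).
Proof.
move=> p0; have qk := periodic_repeat x0 p; rewrite inE.
apply: (iffP (asboolP _)) => [[v /(conjugate_repeat x0 _ p0)[i ->]] | [i ->]].
  rewrite size_block rpow_block // => ti; exists i.
  by apply: val_inj; rewrite /= ti -val_factor_at.
exists (block (repeat_word x0 p) i (size p)).
  by apply/(conjugate_repeat x0 _ p0); exists i.
by rewrite size_block rpow_block // -val_factor_at.
Qed.

(** The triple c = (k, r, q) presents S as a closed walk of k steps along the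
    periodic word q, with an unbordered period at position r. *)
Definition cycle_of n (S : {set n.-tuple A}) (c : (nat * nat) * (nat -> A)) :=
  let: (k, r, q) := c in
  [/\ 0 < k <= n, periodic k q, unbordered_at q r k
    & forall t, t \in S <-> exists i, t = factor_at q i n].

Lemma classn_cycle (x0 : A) p n :
  primitive p -> size p <= n -> exists c, cycle_of (classn p n) c.
Proof.
move=> prim pn; have p0 := primitive_size x0 prim.
have [r unb] := exists_unbordered p0 (periodic_repeat x0 p)
  (fun d => @primitive_repeat x0 p d prim).
exists (size p, r, repeat_word x0 p); split => //; first by rewrite p0.
  exact: periodic_repeat.
by move=> t; split => /(in_classnP x0 _ p0).
Qed.

Definition marked n (c : (nat * nat) * (nat -> A)) : n.-tuple A :=
  factor_at c.2 c.1.2 n.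

Lemma marked_in n (S : {set n.-tuple A}) c : cycle_of S c -> marked n c \in S.
Proof. by case: c => [[k r] q] [_ _ _ inS]; apply/inS; exists r. Qed.

(** If the marked edge of T lies on S, it has the period k of S.  As it starts
    with an unbordered word of length k', the case k < k' is impossible.  If
    k = k', the two periodic words agree over a whole period, so they are
    shifts of each other. *)
Lemma marked_min n (S T : {set n.-tuple A}) c c' :
    cycle_of S c -> cycle_of T c' -> marked n c' \in S ->
  c'.1.1 < c.1.1 \/ T = S.
Proof.
case: c c' => [[k r] q] [[k' r'] q'] [/andP[k0 kn] qk _ inS].
case=> /andP[k'0 k'n] qk' unb inT /inS[i]; rewrite /marked /=.
move=> /eq_factor_at eqq; case: (ltngtP k' k) => [|lt_k|eq_k]; first by left.
  case: (unb k); first by rewrite k0.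
  move=> j jk; rewrite -addnA eqq; last lia.
  by rewrite [k + j]addnC addnA qk eqq //; lia.
right; rewrite {}eq_k {k' k'0 k'n} in qk' unb *.
have {}eqq j : q' (r' + j) = q (i + j).
  by apply: (eq_periodic k0 qk' qk) => l lk; apply/eqq/(leq_trans lk).
(* Positions before r' or i are reached after adding r' or i whole periods. *)
have rk : r' <= r' * k by rewrite leq_pmulr.
have ik : i <= i * k by rewrite leq_pmulr.
apply/setP=> t; apply/idP/idP => [/inT[m ->] | /inS[m ->]].
  apply/inS; exists (i + (m + (r' * k - r'))); apply/eq_factor_at => j _.
  rewrite -addnA -eqq -(periodic_mul r' qk'); congr q'; lia.
apply/inT; exists (r' + (m + (i * k - i))); apply/eq_factor_at => j _.
rewrite -addnA eqq -(periodic_mul i qk); congr q; lia.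
Qed.

(** The other edges of the cycle lead from the end of the marked edge back to
    its start.  None of them equals the marked edge, since a coincidence after
    m + 1 < k steps would be a border of the unbordered word at r. *)
Lemma cycle_potential n (S : {set n.+1.-tuple A}) c (f : n.-tuple A -> bool) :
    cycle_of S c ->
    {in S, forall t, t != marked n.+1 c ->
       f (init_tuple t) = f (tail_tuple t)} ->
  f (init_tuple (marked n.+1 c)) = f (tail_tuple (marked n.+1 c)).
Proof.
case: c => [[k r] q] [/andP[k0 kn] qk unb inS]; rewrite /marked /= => eqf.
rewrite init_factor_at tail_factor_at.
have walk m : m < k -> f (factor_at q r.+1 n) = f (factor_at q (r + m.+1) n).
  elim: m => [|m IHm] mk; first by rewrite addn1.
  rewrite IHm ?(ltnW mk) // [r + m.+2]addnS.
  rewrite -(tail_factor_at q (r + m.+1)) -(init_factor_at q (r + m.+1)).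
  apply: eqf; first by apply/inS; exists (r + m.+1).
  apply/eqP => /eq_factor_at eq_m; case: (unb m.+1) => // j jk.
  by apply: eq_m; lia.
rewrite (walk k.-1) ?prednK ?leqnn //; congr f.
by apply/eq_factor_at => j _; rewrite addnAC qk.
Qed.

End Words.

Theorem theorem9 (A : finType) (w : nat -> A) (n : nat) (hn : (0 < n)%N) :
  ((extLie w n)%:Z <= (complexity w n)%:Z - (complexity w n.-1)%:Z + 1)%R.
Proof.
case: n hn => // n _; rewrite /extLie /complexity [n.+1.-1]/=.
set L := [set S | _].
have [c cP] : {c & forall S, S \in L -> cycle_of S (c S)}.
  apply: (@choice _ _ (fun S c => S \in L -> cycle_of S c)) => S.
  case: (boolP (S \in L)) => [|_]; last by exists (0, 0, w).
  rewrite inE => /asboolP[p [[_ prim] pn _ ->]].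
  by have [c cP] := classn_cycle (w 0) prim pn; exists c.
have LFac S : S \in L -> S \subset Facn w n.+1.
  by rewrite inE => /asboolP[p [_ _ sub ->]].
pose e S := marked n.+1 (c S).
have eFac S : S \in L -> e S \in Facn w n.+1.
  by move=> SL; apply: (subsetP (LFac S SL)); apply/marked_in/cP.
have eL S T : S \in L -> T \in L -> e T \in S -> (c T).1.1 < (c S).1.1 \/ T = S.
  by move=> SL TL; apply: marked_min; apply: cP.
(* If not, each of two classes would be shorter than the other. *)
have e_inj : {in L &, injective e}.
  move=> S T SL TL eqe.
  have [|lt1|//] := eL T S TL SL; first by rewrite eqe; apply/marked_in/cP.
  have [|lt2|//] := eL S T SL TL; first by rewrite -eqe; apply/marked_in/cP.
  by move: (ltn_trans lt1 lt2); rewrite ltnn.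
have sub : e @: L \subset Facn w n.+1.
  by apply/subsetP=> _ /imsetP[S SL ->]; apply: eFac.
have conn : #|Facn w n| <= #|Facn w n.+1 :\: e @: L|.+1.
  apply: (@connected_card_le _ _ (@init_tuple A n) (@tail_tuple A n) _ _
            (factor_at w 0 n)).
  move=> f fK.
  (* Marked edges met on the way round S belong to classes of smaller length. *)
  have fe m S : S \in L -> (c S).1.1 < m ->
      f (init_tuple (e S)) = f (tail_tuple (e S)).
    elim: m S => // m IHm S SL lt_m.
    apply: cycle_potential (cP S SL) _ => t tS t_ne.
    case: (boolP (t \in e @: L)) => [/imsetP[T TL eT] | teL]; last first.
      by apply: fK; rewrite inE teL (subsetP (LFac S SL)).
    rewrite eT in tS t_ne *; apply: IHm => //.
    case: (eL S T SL TL tS) => [lt_T | eqT]; first exact: leq_trans lt_T _.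
    by rewrite eqT eqxx in t_ne.
  have f_all t : t \in Facn w n.+1 -> f (init_tuple t) = f (tail_tuple t).
    move=> tF; case: (boolP (t \in e @: L)) => [/imsetP[T TL ->] | teL].
      exact: (fe _ T TL (ltnSn _)).
    by apply: fK; rewrite inE teL.
  (* The potential is constant along w. *)
  move=> _ /in_FacnP[i ->]; elim: i => // i <-.
  rewrite -tail_factor_at -f_all ?init_factor_at //.
  by apply/in_FacnP; exists i.
rewrite cardsD (setIidPr sub) (card_in_imset e_inj) in conn.
have := subset_leq_card sub; rewrite (card_in_imset e_inj) => leL.
by move: #|L| #|Facn w n| #|Facn w n.+1| conn leL => l v m; lia.
Qed.
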